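(* For $g\geq 2$ and every $x\in \mathcal{T}_{g}$, the diameter locus $\mathcal{L}_d(x)$ is a smoothly embedded finite graph, of dimension at most one, on the marked hyperbolic surface $S_{g}$ corresponding to $x$.
   Context: $\mathcal{T}_{g}$ denotes the Teichm\''uller space of closed, connected surfaces of genus $g$; a point $x\in\mathcal{T}_g$ determines a marked closed hyperbolic surface $S_g$. The diameter locus $\mathcal{L}_{d}(x)$ is the locus of pairs of points $p_{1},p_{2}$ in $S_{g}$ for which the distance $d(p_{1},p_{2})$ in the hyperbolic metric on $S_g$ is equal to the diameter of $S_{g}$; it is viewed as a subset of $S_g$, consisting of all points of $S_g$ belonging to such a pair. A graph of dimension at most one may consist only of isolated vertices (dimension $0$) or may also have edges (dimension $1$). *)

(* Defs.v *)
From HB Require Import structures.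
From mathcomp Require Import all_boot all_order all_algebra.
From mathcomp Require Import all_classical all_reals all_analysis.
From mathcomp Require Import complex ring.

Set Implicit Arguments.
Unset Strict Implicit.
Unset Printing Implicit Defensive.

Import Order.TTheory GRing.Theory Num.Theory numFieldNormedType.Exports.
Local Open Scope classical_set_scope.
Local Open Scope ring_scope.
Local Open Scope complex_scope.
Local Open Scope quotient_scope.

(** * The hyperbolic plane (upper half-plane model) *)

Record upper (R : realType) := Upper {
  upper_val :> R[i];
  upper_gt0 : 0 < complex.Im upper_val }.

HB.instance Definition _ (R : realType) := [isSub for @upper_val R].
HB.instance Definition _ (R : realType) := [Choice of upper R by <:].

Definition arcosh (R : realType) (u : R) : R := ln (u + Num.sqrt (u ^+ 2 - 1)).

Definition hyp_dist (R : realType) (z w : upper R) : R :=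
  arcosh (1 + ((complex.Re z - complex.Re w) ^+ 2 +
               (complex.Im z - complex.Im w) ^+ 2) /
              (2 * complex.Im z * complex.Im w)).

Definition mobius (R : realType) (M : 'M[R]_2) (z : R[i]) : R[i] :=
  ((M 0 0)%:C * z + (M 0 1)%:C) / ((M 1 0)%:C * z + (M 1 1)%:C).

(** Equality of two matrices of SL(2,R) in PSL(2,R). *)
Definition psl_eq (R : realType) (M N : 'M[R]_2) : Prop := M = N \/ M = - N.

(** * The fundamental group of the closed orientable surface of genus [g]

    Elements are represented by words in the generators a_i = (i, false) and
    b_i = (i, true); a letter (s, true) is the inverse of the generator s. *)

Definition generator (g : nat) : Type := ('I_g * bool)%type.
Definition letter (g : nat) : Type := (generator g * bool)%type.
Definition word (g : nat) : Type := seq (letter g).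

Definition surface_relator (g : nat) : word g :=
  flatten [seq [:: ((i, false), false); ((i, true), false);
                   ((i, false), true); ((i, true), true)] | i <- enum 'I_g].

Inductive pi1_eq (g : nat) : word g -> word g -> Prop :=
| Pi1Refl u : pi1_eq u u
| Pi1Sym u v : pi1_eq u v -> pi1_eq v u
| Pi1Trans u v w : pi1_eq u v -> pi1_eq v w -> pi1_eq u w
| Pi1Cat u u' v v' : pi1_eq u u' -> pi1_eq v v' -> pi1_eq (u ++ v) (u' ++ v')
| Pi1Cancel s b : pi1_eq [:: (s, b); (s, ~~ b)] [::]
| Pi1Relator : pi1_eq (surface_relator g) [::].

Definition eval_letter (R : realType) (g : nat) (rho : generator g -> 'M[R]_2)
    (l : letter g) : 'M[R]_2 :=
  if l.2 then invmx (rho l.1) else rho l.1.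

Definition eval_word (R : realType) (g : nat) (rho : generator g -> 'M[R]_2)
    (w : word g) : 'M[R]_2 :=
  foldr (fun l M => eval_letter rho l *m M) 1%:M w.

(** * Marked closed hyperbolic surfaces and Teichmueller space

    A marked closed hyperbolic surface of genus [g] is the quotient of the
    hyperbolic plane by a group of orientation-preserving isometries acting
    freely, properly discontinuously and cocompactly, together with an
    isomorphism (the marking) from the fundamental group onto this group.  The
    marking is given by matrices representing the images of the generators in
    PSL(2,R).  Compact sets are replaced by closed balls, which are compact and
    exhaust the hyperbolic plane. *)

Record marked_surface (R : realType) (g : nat) := MarkedSurface {
  hol : generator g -> 'M[R]_2;
  hol_det : forall s, \det (hol s) = 1;
  hol_faithful : forall u v : word g,
    pi1_eq u v <-> psl_eq (eval_word hol u) (eval_word hol v);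
  hol_free : forall (w : word g) (z : upper R),
    mobius (eval_word hol w) z = z -> psl_eq (eval_word hol w) 1%:M;
  hol_properly_discontinuous : forall (z0 : upper R) (r : R),
    finite_set [set M : 'M[R]_2 | range (eval_word hol) M /\
      exists z z' : upper R, [/\ mobius M z = z' :> R[i],
        hyp_dist z0 z <= r & hyp_dist z0 z' <= r]];
  hol_cocompact : exists (z0 : upper R) (r : R), forall z : upper R,
    exists (w : word g) (z' : upper R),
      mobius (eval_word hol w) z = z' :> R[i] /\ hyp_dist z0 z' <= r }.

HB.instance Definition _ (R : realType) (g : nat) :=
  gen_eqMixin (marked_surface R g).
HB.instance Definition _ (R : realType) (g : nat) :=
  gen_choiceMixin (marked_surface R g).

(** Two marked surfaces define the same point of Teichmueller space when their
    holonomies are conjugate by an isometry of the hyperbolic plane, that is, by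
    an element of PGL(2,R) (a negative determinant reverses the orientation). *)
Definition teich_equiv (R : realType) (g : nat) : rel (marked_surface R g) :=
  fun X Y => `[< exists2 P : 'M[R]_2, P \in unitmx &
    forall s, psl_eq (hol Y s) (P *m hol X s *m invmx P) >].

Lemma teich_equiv_refl (R : realType) (g : nat) :
  reflexive (@teich_equiv R g).
Proof.
move=> X; apply/asboolP; exists 1%:M; first exact: unitmx1.
by move=> s; left; rewrite invmx1 mulmx1 mul1mx.
Qed.

Lemma teich_equiv_imp (R : realType) (g : nat) (X Y : marked_surface R g) :
  teich_equiv X Y -> teich_equiv Y X.
Proof.
move=> /asboolP[P uP XY]; apply/asboolP; exists (invmx P).
  by rewrite unitmx_inv.
have PK (A : 'M[R]_2) : invmx P *m (P *m A *m invmx P) *m P = A.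
  by rewrite -!mulmxA mulVmx// mulmx1 mulKmx.
move=> s; rewrite invmxK; case: (XY s) => ->; [left|right].
  by rewrite PK.
by rewrite mulmxN mulNmx PK opprK.
Qed.

Lemma teich_equiv_sym (R : realType) (g : nat) : symmetric (@teich_equiv R g).
Proof. by move=> X Y; apply/idP/idP; apply: teich_equiv_imp. Qed.

Lemma teich_equiv_trans (R : realType) (g : nat) :
  transitive (@teich_equiv R g).
Proof.
move=> Y X Z /asboolP[P uP XY] /asboolP[Q uQ YZ]; apply/asboolP.
exists (Q *m P); first by rewrite unitmx_mul uQ.
have uQP : Q *m P \in unitmx by rewrite unitmx_mul uQ.
have iE : invmx (Q *m P) = invmx P *m invmx Q.
  apply: (can_inj (mulKmx uQP)).
  by rewrite mulmxV// -mulmxA (mulmxA P) mulmxV// mul1mx mulmxV.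
move=> s; rewrite iE; case: (YZ s) => ->; case: (XY s) => ->;
  rewrite ?(mulmxN, mulNmx) ?opprK !mulmxA; by [left|right].
Qed.

Canonical teich_equiv_equiv (R : realType) (g : nat) :=
  EquivRel (@teich_equiv R g) (@teich_equiv_refl R g) (@teich_equiv_sym R g)
    (@teich_equiv_trans R g).

Definition teichmuller (R : realType) (g : nat) : Type :=
  {eq_quot (@teich_equiv R g)}.

Definition teich_class (R : realType) (g : nat) (X : marked_surface R g) :
  teichmuller R g := \pi X.

(** * The quotient surface and its metric *)

Definition orbit_equiv (R : realType) (g : nat) (X : marked_surface R g) :
    rel (upper R) :=
  fun z z' => `[< exists w : word g,
    mobius (eval_word (hol X) w) z = z' :> R[i] >].

Section OrbitEquiv.
Variables (R : realType) (g : nat) (X : marked_surface R g).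

Lemma eval_word_cat (u v : word g) :
  eval_word (hol X) (u ++ v) = eval_word (hol X) u *m eval_word (hol X) v.
Proof. by elim: u => [|l u IH] /=; rewrite ?mul1mx// IH mulmxA. Qed.

Lemma eval_word_det (u : word g) : \det (eval_word (hol X) u) = 1.
Proof.
elim: u => [|[s b] u IH] /=; first exact: det1.
by rewrite det_mulmx IH mulr1 /eval_letter/=; case: b;
  rewrite ?det_inv hol_det ?invr1.
Qed.

Lemma mobius1 (z : R[i]) : mobius 1%:M z = z.
Proof. by rewrite /mobius !mxE /= !mul1r addr0 mul0r add0r divr1. Qed.

Lemma det2 (M : 'M[R]_2) : \det M = M 0 0 * M 1 1 - M 0 1 * M 1 0.
Proof.
rewrite (expand_det_row _ 0) !big_ord_recl big_ord0 addr0 /cofactor !det_mx11.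
rewrite !mxE /= expr0 mul1r expr1 mulN1r mulrN.
by congr (_ * _ - _ * _); congr (M _ _); apply/val_inj.
Qed.

Lemma mulmx2 (M N : 'M[R]_2) i j : (M *m N) i j = M i 0 * N 0 j + M i 1 * N 1 j.
Proof.
rewrite !mxE !big_ord_recl big_ord0 addr0.
by congr (_ + M _ _ * N _ _); apply/val_inj.
Qed.

Lemma mobius_den (M : 'M[R]_2) (z : upper R) : \det M = 1 ->
  (M 1 0)%:C * (z : R[i]) + (M 1 1)%:C != 0.
Proof.
case: z => -[x y] /= y0; rewrite det2 => dM; apply/eqP => -[].
rewrite !mul0r subr0 !addr0 => E1 /eqP; rewrite mulf_eq0 (gt_eqF y0) orbF.
move=> /eqP c0; move: E1; rewrite c0 mul0r add0r => d0.
by move: dM => /eqP; rewrite c0 d0 !mulr0 subr0 eq_sym oner_eq0.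
Qed.

Lemma mobiusM (M N : 'M[R]_2) (z z' : upper R) :
  \det M = 1 -> \det N = 1 -> mobius N z = z' ->
  mobius (M *m N) z = mobius M z'.
Proof.
move=> dM dN zz'; have := mobius_den z' dM; have := mobius_den z dN.
have : \det (M *m N) = 1 by rewrite det_mulmx dM dN mulr1.
move=> /(mobius_den z); rewrite -zz' /mobius !mulmx2 !(rmorphD, rmorphM) /=.
move: (z : R[i]) => t; move: (M 0 0)%:C (M 0 1)%:C (M 1 0)%:C (M 1 1)%:C.
move: (N 0 0)%:C (N 0 1)%:C (N 1 0)%:C (N 1 1)%:C => a b c d e f h k D1 D2 D3.
by field; rewrite D2 /=; apply: contraNN D1 => /eqP E; apply/eqP; rewrite -[RHS]E; ring.
Qed.

Definition inv_word (u : word g) : word g := rev [seq (l.1, ~~ l.2) | l <- u].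

Lemma inv_wordK (u : word g) :
  eval_word (hol X) (inv_word u) *m eval_word (hol X) u = 1%:M.
Proof.
have uh s : hol X s \in unitmx by rewrite unitmxE hol_det unitr1.
elim: u => [|[s b] u IH] /=; first by rewrite mulmx1.
rewrite /inv_word /= rev_cons -cats1 eval_word_cat /= mulmx1 -mulmxA.
rewrite (mulmxA (eval_letter _ (s, ~~ b))) /eval_letter /=.
by case: b; rewrite /= ?(mulmxV, mulVmx)// mul1mx.
Qed.

Lemma orbit_equiv_refl : reflexive (orbit_equiv X).
Proof. by move=> z; apply/asboolP; exists [::]; rewrite /= mobius1. Qed.

Lemma orbit_equiv_imp z z' : orbit_equiv X z z' -> orbit_equiv X z' z.
Proof.
move=> /asboolP[w zz']; apply/asboolP; exists (inv_word w).
by rewrite -(mobiusM _ _ zz') ?eval_word_det// inv_wordK mobius1.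
Qed.

Lemma orbit_equiv_sym : symmetric (orbit_equiv X).
Proof. by move=> z z'; apply/idP/idP; exact: orbit_equiv_imp. Qed.

Lemma orbit_equiv_trans : transitive (orbit_equiv X).
Proof.
move=> z' z z'' /asboolP[u zz'] /asboolP[v z'z'']; apply/asboolP.
by exists (v ++ u); rewrite eval_word_cat (mobiusM _ _ zz') ?eval_word_det.
Qed.

End OrbitEquiv.

Canonical orbit_equiv_equiv (R : realType) (g : nat) (X : marked_surface R g) :=
  EquivRel (orbit_equiv X) (@orbit_equiv_refl R g X) (@orbit_equiv_sym R g X)
    (@orbit_equiv_trans R g X).

Definition surface (R : realType) (g : nat) (X : marked_surface R g) : Type :=
  {eq_quot (orbit_equiv X)}.

Definition surface_proj (R : realType) (g : nat) (X : marked_surface R g)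
  (z : upper R) : surface X := \pi z.

Definition surface_dist (R : realType) (g : nat) (X : marked_surface R g)
    (p q : surface X) : R :=
  inf [set d | exists z w : upper R, [/\ surface_proj X z = p,
    surface_proj X w = q & d = hyp_dist z w]].

Definition diameter (R : realType) (g : nat) (X : marked_surface R g) : R :=
  sup [set d | exists p q : surface X, d = surface_dist p q].

Definition diameter_pairs (R : realType) (g : nat) (X : marked_surface R g) :
    set (surface X * surface X) :=
  [set pq | surface_dist pq.1 pq.2 = diameter X].
Arguments diameter_pairs {R g} X _.

Definition diameter_locus (R : realType) (g : nat) (X : marked_surface R g) :
    set (surface X) :=
  [set p | exists2 pq, diameter_pairs X pq & p = pq.1 \/ p = pq.2].
Arguments diameter_locus {R g} X _.

(** * Smoothly embedded finite graphs

    Since the projection to the surface is a local diffeomorphism, a smooth arc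
    in the surface is the projection of a smooth arc in the hyperbolic plane.
    An arc is parametrised by the interval [0, 1], at the points of which its
    velocity does not vanish; asking for a smooth map on the whole line amounts
    to asking for smoothness up to the end points. *)

Record finite_graph (R : realType) (g : nat) (X : marked_surface R g) :=
  FiniteGraph {
    vertices : seq (surface X);
    num_edges : nat;
    edge : 'I_num_edges -> R -> upper R }.
Arguments edge {R g X} _ _ _.

Definition smooth (R : realType) (f : R -> R) : Prop :=
  forall (n : nat) (t : R), derivable (derive1n n f) t 1.

Definition smooth_regular_arc (R : realType) (c : R -> upper R) : Prop :=
  let x t := complex.Re (c t) in
  let y t := complex.Im (c t) in
  [/\ smooth x, smooth y &
    forall t : R, 0 <= t <= 1 -> ~ (derive1 x t = 0 /\ derive1 y t = 0)].

(** The open edges are disjoint from each other and from the vertices; loops and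
    multiple edges are allowed. *)
Definition smoothly_embedded (R : realType) (g : nat) (X : marked_surface R g)
    (G : finite_graph X) : Prop :=
  [/\ forall i, smooth_regular_arc (edge G i),
      forall i, surface_proj X (edge G i 0) \in vertices G /\
        surface_proj X (edge G i 1) \in vertices G,
      forall i (t : R), 0 < t < 1 ->
        surface_proj X (edge G i t) \notin vertices G &
      forall i j (s t : R), 0 < s < 1 -> 0 < t < 1 ->
        surface_proj X (edge G i s) = surface_proj X (edge G j t) ->
        i = j /\ s = t].

Definition graph_support (R : realType) (g : nat) (X : marked_surface R g)
    (G : finite_graph X) : set (surface X) :=
  [set p | p \in vertices G \/ exists (i : 'I_(num_edges G)) (t : R),
    0 <= t <= 1 /\ surface_proj X (edge G i t) = p].

Definition graph_dim (R : realType) (g : nat) (X : marked_surface R g)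
    (G : finite_graph X) : nat :=
  if num_edges G is 0%N then 0%N else 1%N.

(* Main.v *)
Require Import Defs.
From mathcomp Require Import all_boot all_order all_algebra.
From mathcomp Require Import all_classical all_reals all_analysis.
From mathcomp Require Import complex ring lra.

(** The diameter locus turns out to be a finite set, so that a graph without
    edges carries it.

    Lift a pair of points of the surface to (z, w) in the product of two
    hyperbolic planes.  For each deck transformation M let f_M(z, w) be
    cosh d(z, M w), and let K be the hyperbolic cosine of the diameter.  The
    distance on the surface is the minimum over M, hence every (z, w) has some
    M with f_M(z, w) <= K, whereas a lift of a pair realising the diameter
    satisfies f_M(z, w) >= K for all M; call such a lift extremal.  Extremal
    lifts are isolated ([extremal_isolated]).  Indeed, let (p0, q0) and
    (p1, q1) be two distinct extremal lifts close to each other, and follow the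
    product geodesic from the first through the second up to the double time,
    that is, up to (p2, q2), where p2 and q2 are the point reflections of p0 in
    p1 and of q0 in q1.  Some M has f_M <= K at (p2, q2), and by proper
    discontinuity and nearness f_M = K at (p0, q0).  Along the geodesic f_M is
    convex, equals K at time 0, is at least K at time 1 and at most K at time
    2; so it is constant, and the equality case of convexity ([mink_convex])
    says that p and q slide along the very geodesic that joins p to M q.  Now
    move p2 off that geodesic in the normal direction: all these f_M increase
    strictly, the other ones remain above K, and no M is left with f_M <= K
    ([no_neutral_normal]), which is absurd.

    By cocompactness every pair realising the diameter has a lift in a fixed
    compact set, and a compact set contains finitely many isolated points
    ([finite_extremal]).

    Computations take place on the hyperboloid in Minkowski space, where
    cosh d is a bilinear form, deck transformations are linear and point
    reflections are polynomial; the convexity of f_M reduces to a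
    Cauchy-Schwarz inequality whose defect is a sum of squares of
    determinants ([mink_tangent_defect]). *)

Set Implicit Arguments.
Unset Strict Implicit.
Unset Printing Implicit Defensive.

Import Order.TTheory GRing.Theory Num.Theory numFieldNormedType.Exports.
Local Open Scope classical_set_scope.
Local Open Scope ring_scope.

(** * The Minkowski form *)

Section LorentzAlgebra.
Variable R : realFieldType.
Implicit Types p q u : R * R * R.

(** A vector (a, b, c) stands for the symmetric matrix with rows (a, b) and
    (b, c).  This is the polarisation of its determinant a c - b^2, a form of
    signature (1, 2). *)
Definition mink p q : R := (p.1.1 * q.2 + p.2 * q.1.1) / 2 - p.1.2 * q.1.2.

Definition comb (a : R) p (b : R) q : R * R * R :=
  (a * p.1.1 + b * q.1.1, a * p.1.2 + b * q.1.2, a * p.2 + b * q.2).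

Definition vdet p q u : R :=
  p.1.1 * (q.1.2 * u.2 - q.2 * u.1.2) - p.1.2 * (q.1.1 * u.2 - q.2 * u.1.1)
  + p.2 * (q.1.1 * u.1.2 - q.1.2 * u.1.1).

(** The vector representing the linear form [vdet p q] with respect to
    [mink]. *)
Definition mcross p q : R * R * R :=
  (2 * (p.1.1 * q.1.2 - p.1.2 * q.1.1), p.1.1 * q.2 - p.2 * q.1.1,
   2 * (p.1.2 * q.2 - p.2 * q.1.2)).

(** The point reflection of [q] in [p] when [mink p p = 1]: the geodesic from
    [q] to [p], continued by its own length. *)
Definition preflect p q := comb (2 * mink p q) p (-1) q.

Lemma minkC p q : mink p q = mink q p.
Proof. by rewrite /mink; ring. Qed.

Lemma mink_combl a p b q u :
  mink (comb a p b q) u = a * mink p u + b * mink q u.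
Proof. by rewrite /mink /=; ring. Qed.

Lemma mink_combr a p b q u :
  mink u (comb a p b q) = a * mink u p + b * mink u q.
Proof. by rewrite /mink /=; ring. Qed.

Lemma mink_cross p q u : mink (mcross p q) u = vdet p q u.
Proof. by rewrite /mink /vdet /=; field. Qed.

(** The factor 4 is the inverse of the determinant of the form [mink] in the
    standard basis. *)
Lemma gram_det p q u :
  vdet p q u ^+ 2 / 4 =
    mink p p * (mink q q * mink u u - mink q u ^+ 2)
    - mink p q * (mink p q * mink u u - mink q u * mink p u)
    + mink p u * (mink p q * mink q u - mink q q * mink p u).
Proof. by rewrite /mink /vdet; field. Qed.

Lemma mink_crossxx p q :
  mink (mcross p q) (mcross p q) = 4 * (mink p p * mink q q - mink p q ^+ 2).
Proof. by rewrite /mink /=; field. Qed.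

Lemma mink_preflect p q : mink p p = 1 -> mink q q = 1 ->
  mink (preflect p q) (preflect p q) = 1.
Proof.
move=> pp qq.
by rewrite /preflect mink_combl !mink_combr pp qq (minkC q p); ring.
Qed.

(** The triangle inequality in the weak form
    cosh (a + b) <= 2 cosh a cosh b, which is enough to compare bounded
    regions; it follows from the nonnegativity of a Gram determinant. *)
Lemma mink_triangle o p q : mink o o = 1 -> mink p p = 1 -> mink q q = 1 ->
  1 <= mink o p -> 1 <= mink o q -> mink p q <= 2 * mink o p * mink o q.
Proof.
move=> oo pp qq; have := gram_det o p q; rewrite oo pp qq.
move: (mink o p) (mink o q) (mink p q) (vdet _ _ _ ^+ 2) (sqr_ge0 (vdet o p q)).
move=> a b c d d0 dE a1 b1; have ab0 : 0 <= a * b by apply: mulr_ge0; lra.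
have H : (c - a * b) ^+ 2 <= (a * b) ^+ 2.
  have E : (a ^+ 2 - 1) * (b ^+ 2 - 1) - (c - a * b) ^+ 2 = d / 4.
    by rewrite dE; ring.
  have : 0 <= a ^+ 2 + b ^+ 2 - 1 by nra.
  by move: E; nra.
by rewrite leNgt; apply/negP => ?; nra.
Qed.

(** Cauchy-Schwarz inequality for vectors [x] and [y] tangent to the hyperboloid
    at two different points.  Tangent vectors are spacelike, so both terms on
    the right are nonnegative; they vanish when [x] and [y] point along
    the geodesic through [p] and [q].  The identity comes from writing both
    squares as Gram determinants. *)
Lemma mink_tangent_defect p q x y : mink p p = 1 -> mink q q = 1 ->
  mink p x = 0 -> mink q y = 0 ->
  mink x x * mink y y * mink p q ^+ 2 - mink x y ^+ 2 =
    (vdet p x y ^+ 2 - mink x x * vdet p q y ^+ 2) / 4.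
Proof.
move=> pp qq px qy.
transitivity (vdet p x y ^+ 2 / 4 - mink x x * (vdet p q y ^+ 2 / 4));
  last by ring.
by rewrite !gram_det pp qq px qy; ring.
Qed.

(** Convexity of cosh d along product geodesics, at the equidistant times 0, 1
    and 2, with its equality case.  Writing p0 = a p1 - x and q0 = b q1 - y with
    x, y tangent, the values f0, f1, f2 satisfy
    f0 + f2 = 2 a b f1 + 2 mink x y, and |mink x y| is at most (a b - 1) f1
    because (a^2 - 1) (b^2 - 1) = (a b - 1)^2 - (a - b)^2.  If f2 <= f0 <= f1,
    all these inequalities are equalities: both points move by the same amount
    and along the geodesic that joins them. *)
Lemma mink_convex p0 p1 q0 q1 :
  mink p0 p0 = 1 -> mink p1 p1 = 1 -> mink q0 q0 = 1 -> mink q1 q1 = 1 ->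
  1 <= mink p1 p0 -> 1 <= mink q1 q0 -> 1 < mink p1 p0 \/ 1 < mink q1 q0 ->
  1 <= mink p0 q0 <= mink p1 q1 ->
  mink (preflect p1 p0) (preflect q1 q0) <= mink p0 q0 ->
  [/\ mink (preflect p1 p0) (preflect q1 q0) = mink p0 q0, 1 < mink p1 p0 &
      vdet p1 p0 (preflect q1 q0) = 0].
Proof.
move=> pp0 pp1 qq0 qq1 a1 b1 ab1 /andP[K1 K12].
set a := mink p1 p0 in a1 ab1 *; set b := mink q1 q0 in b1 ab1 *.
pose x := comb a p1 (-1) p0; pose y := comb b q1 (-1) q0.
have p1x : mink p1 x = 0 by rewrite mink_combr pp1 -/a; ring.
have q1y : mink q1 y = 0 by rewrite mink_combr qq1 -/b; ring.
have xx : mink x x = 1 - a ^+ 2.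
  by rewrite mink_combl p1x mink_combr pp0 (minkC p0) -/a; ring.
have yy : mink y y = 1 - b ^+ 2.
  by rewrite mink_combl q1y mink_combr qq0 (minkC q0) -/b; ring.
have f2E : mink (preflect p1 p0) (preflect q1 q0) =
    2 * a * b * mink p1 q1 + 2 * mink x y - mink p0 q0.
  by rewrite !(mink_combl, mink_combr) -/a -/b; ring.
have E1 := mink_tangent_defect pp1 qq1 p1x q1y.
have E2 := mink_tangent_defect qq1 pp1 q1y p1x.
rewrite xx yy in E1 E2; rewrite minkC [mink y x]minkC in E2.
move: E1 E2 f2E; set xi := mink x y; set K := mink p0 q0 in K1 K12 *.
set f := mink p1 q1 in K12 * => E1 E2 -> le2.
have s1 := sqr_ge0 (vdet p1 x y); have s2 := sqr_ge0 (vdet p1 q1 y).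
have s3 := sqr_ge0 (vdet q1 y x); have s4 := sqr_ge0 (vdet q1 p1 x).
have f1 : 1 <= f by lra.
have ab : 1 <= a * b by nra.
have a2_ge0 : 0 <= (a ^+ 2 - 1) * vdet p1 q1 y ^+ 2.
  by rewrite mulr_ge0// subr_ge0 -[1](expr1n _ 2) ler_sqr ?nnegrE; lra.
have xi2 : xi ^+ 2 <= ((a * b - 1) * f) ^+ 2.
  have : 0 <= (a - b) ^+ 2 * f ^+ 2 by rewrite mulr_ge0 ?sqr_ge0.
  by move: E1; lra.
have abf : 0 <= (a * b - 1) * f by apply: mulr_ge0; lra.
have xi_ge : - ((a * b - 1) * f) <= xi by rewrite leNgt; apply/negP => ?; nra.
have fK : f = K by lra.
have xiE : xi = - ((a * b - 1) * f) by lra.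
have abE : a = b.
  have : (a - b) ^+ 2 * f ^+ 2 =
      - ((1 - a ^+ 2) * (1 - b ^+ 2) * f ^+ 2 - xi ^+ 2).
    by rewrite xiE; ring.
  rewrite E1 => E; have le0 : ((a - b) * f) ^+ 2 <= 0 by rewrite exprMn; lra.
  have /eqP : ((a - b) * f) ^+ 2 = 0 by apply/le_anti; rewrite le0 sqr_ge0.
  by rewrite sqrf_eq0 mulf_eq0 subr_eq0 => /orP[/eqP//|/eqP]; lra.
have a_gt1 : 1 < a by lra.
rewrite -abE in E1 E2.
have xi0 : (1 - a ^+ 2) * (1 - a ^+ 2) * f ^+ 2 - xi ^+ 2 = 0.
  by rewrite xiE -abE; ring.
have a2 : 0 < a ^+ 2 - 1 by nra.
have d1 : vdet p1 x y = 0 by apply/eqP; rewrite -sqrf_eq0; apply/eqP; nra.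
have d2 : vdet q1 p1 x = 0 by apply/eqP; rewrite -sqrf_eq0; apply/eqP; nra.
split => //; first by rewrite xiE fK; ring.
have -> : vdet p1 p0 (preflect q1 q0) = - vdet p1 x y - b * vdet q1 p1 x.
  by rewrite /preflect -/b /vdet /=; ring.
by rewrite d1 d2; ring.
Qed.

End LorentzAlgebra.

(** * The half-plane as a hyperboloid *)

Section Hyperboloid.
Variable R : realType.
Implicit Types (z w : upper R) (M : 'M[R]_2) (p : R * R * R).

Definition coords z : R * R := (complex.Re z, complex.Im z).

(** The isometry from the half-plane onto the upper sheet of the hyperboloid:
    x + i y goes to the matrix of determinant 1 with entries (x^2 + y^2) / y,
    x / y, 1 / y. *)
Definition hpt (t : R * R) : R * R * R :=
  ((t.1 ^+ 2 + t.2 ^+ 2) / t.2, t.1 / t.2, t.2^-1).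

Definition hvec z := hpt (coords z).

(** The congruence of the symmetric matrix of [p] by [M], that is, M S M^T. *)
Definition act M p : R * R * R :=
  (M 0 0 ^+ 2 * p.1.1 + 2 * M 0 0 * M 0 1 * p.1.2 + M 0 1 ^+ 2 * p.2,
   M 0 0 * M 1 0 * p.1.1 + (M 0 0 * M 1 1 + M 0 1 * M 1 0) * p.1.2
     + M 0 1 * M 1 1 * p.2,
   M 1 0 ^+ 2 * p.1.1 + 2 * M 1 0 * M 1 1 * p.1.2 + M 1 1 ^+ 2 * p.2).

Lemma coords_inj : injective coords.
Proof.
move=> [[x y] hz] [[x' y'] hw] [/= xx yy].
by apply/val_inj => /=; rewrite xx yy.
Qed.

Lemma mink_hvec z w : mink (hvec z) (hvec w) =
  1 + ((complex.Re z - complex.Re w) ^+ 2 +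
       (complex.Im z - complex.Im w) ^+ 2) /
      (2 * complex.Im z * complex.Im w).
Proof.
case: z w => [[x y] /= y0] [[x' y'] /= y0']; rewrite /mink /=.
by field; rewrite !gt_eqF.
Qed.

Lemma hyp_distE z w : hyp_dist z w = arcosh (mink (hvec z) (hvec w)).
Proof. by rewrite mink_hvec. Qed.

Lemma mink_hvec_ge1 z w : 1 <= mink (hvec z) (hvec w).
Proof.
rewrite mink_hvec lerDl divr_ge0 ?addr_ge0 ?sqr_ge0// !mulr_ge0// ltW//;
  exact: upper_gt0.
Qed.

Lemma mink_hvec_eq1 z w : mink (hvec z) (hvec w) = 1 -> z = w.
Proof.
case: z w => [[x y] y0] [[x' y'] y0']; rewrite mink_hvec /= => H.
have : ((x - x') ^+ 2 + (y - y') ^+ 2) / (2 * y * y') = 0 by lra.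
move/eqP; rewrite mulf_eq0 invr_eq0 !mulf_eq0 pnatr_eq0 /=.
rewrite (gt_eqF y0) (gt_eqF y0') !orbF paddr_eq0 ?sqr_ge0// !sqrf_eq0 !subr_eq0.
by move=> /andP[/eqP xx /eqP yy]; apply/coords_inj; rewrite /coords /= xx yy.
Qed.

Lemma mink_hvecxx z : mink (hvec z) (hvec z) = 1.
Proof. by rewrite mink_hvec !subrr expr0n addr0 mul0r addr0. Qed.

Lemma hvec_surj p : mink p p = 1 -> 0 < p.2 -> exists z, hvec z = p.
Proof.
case: p => [[a b] c] /= E c0.
have y0 : 0 < c^-1 by rewrite invr_gt0.
exists (@Upper R (Complex (b / c) c^-1) y0).
have E' : a = (1 + b ^+ 2) / c.
  have : a * c = 1 + b ^+ 2 by move: E; rewrite /mink/=; lra.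
  by move=> <-; field; rewrite gt_eqF.
by rewrite /hvec /hpt /= E'; congr (_, _, _); field; rewrite ?gt_eqF.
Qed.

Lemma mink_act M p q : \det M = 1 -> mink (act M p) (act M q) = mink p q.
Proof.
rewrite det2 => dM.
transitivity ((M 0 0 * M 1 1 - M 0 1 * M 1 0) ^+ 2 * mink p q).
  by rewrite /mink /=; field.
by rewrite dM expr1n mul1r.
Qed.

Lemma act_comb M a p b q : act M (comb a p b q) = comb a (act M p) b (act M q).
Proof. by rewrite /act /comb /=; congr (_, _, _); ring. Qed.

(** Moebius transformations act linearly on the hyperboloid. *)
Lemma mobius_upper M z : \det M = 1 ->
  exists2 w : upper R, mobius M z = w :> R[i] & hvec w = act M (hvec z).
Proof.
move=> dM; have := mobius_den z dM; move: dM; rewrite det2.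
case: z => [[x y] /= y0] dM den.
set D := (M 1 0 * x + M 1 1) ^+ 2 + (M 1 0 * y) ^+ 2.
set N := (M 0 0 * x + M 0 1) * (M 1 0 * x + M 1 1) + M 0 0 * M 1 0 * y ^+ 2.
have D0 : D != 0.
  rewrite paddr_eq0 ?sqr_ge0// !sqrf_eq0.
  apply: contraNN den => /andP[/eqP d1 /eqP d2].
  by rewrite eq_complex /= !mul0r !addr0 subr0 d1 d2 eqxx.
have mE : mobius M (Complex x y) = Complex (N / D) (y / D).
  rewrite /mobius; apply/eqP.
  rewrite eq_complex /= !mul0r !addr0 !subr0; apply/andP.
  rewrite -!/D /N; split; apply/eqP; first by field.
  by rewrite -[X in _ = X / D]mul1r -dM; field.
have Dgt0 : 0 < D by rewrite lt_neqAle eq_sym D0 addr_ge0 ?sqr_ge0.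
have yD : 0 < y / D by rewrite divr_gt0.
exists (Upper (upper_val := Complex (N / D) (y / D)) yD) => //=.
rewrite /hvec /hpt /act /=; congr (_, _, _); last 2 first.
- by rewrite /D /N; field; rewrite (gt_eqF y0).
- by rewrite /D; field; rewrite (gt_eqF y0).
(* |a z + b|^2 |c z + d|^2 = |(a z + b) (c z^* + d)|^2 *)
have E : N ^+ 2 + ((M 0 0 * M 1 1 - M 0 1 * M 1 0) * y) ^+ 2 =
    ((M 0 0 * x + M 0 1) ^+ 2 + (M 0 0 * y) ^+ 2) * D by rewrite /D /N; ring.
move: E; rewrite dM mul1r => E; rewrite !expr_div_n -mulrDl E.
by field; rewrite (gt_eqF y0).
Qed.

End Hyperboloid.

(** * Limits *)

Lemma near_finite (T : Type) (F : set_system T) (FF : Filter F)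
    (I : choiceType) (A : set I) (P : I -> T -> Prop) : finite_set A ->
  (forall i, A i -> \forall t \near F, P i t) ->
  \forall t \near F, forall i, A i -> P i t.
Proof. by case/finite_fsetP => B -> H; exact: (filter_bigI FF). Qed.

Section VectorLimits.
Variables (R : realType) (T : Type) (F : set_system T) (FF : Filter F).
Implicit Types (f g : T -> R * R * R) (p q : R * R * R).

Definition vcvg f p := [/\ (fun t => (f t).1.1) @ F --> p.1.1,
  (fun t => (f t).1.2) @ F --> p.1.2 & (fun t => (f t).2) @ F --> p.2].

Lemma vcvg_cst p : vcvg (fun=> p) p.
Proof. by split; exact: cvg_cst. Qed.

Lemma vcvg_comb (a b : T -> R) (x y : R) f g p q : a @ F --> x -> b @ F --> y ->
  vcvg f p -> vcvg g q ->
  vcvg (fun t => comb (a t) (f t) (b t) (g t)) (comb x p y q).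
Proof.
move=> ax by_ [f1 f2 f3] [g1 g2 g3].
by split; apply: cvgD; apply: cvgM.
Qed.

Lemma cvg_mink f g p q : vcvg f p -> vcvg g q ->
  (fun t => mink (f t) (g t)) @ F --> mink p q.
Proof.
move=> [f1 f2 f3] [g1 g2 g3]; apply: cvgB; last exact: cvgM.
by apply: cvgM; [apply: cvgD; exact: cvgM|exact: cvg_cst].
Qed.

Lemma vcvg_preflect f g p q : vcvg f p -> vcvg g q ->
  vcvg (fun t => preflect (f t) (g t)) (preflect p q).
Proof.
move=> fp gq; apply: vcvg_comb => //; last exact: cvg_cst.
by apply: cvgM; [exact: cvg_cst|exact: cvg_mink].
Qed.

Lemma vcvg_act M f p : vcvg f p -> vcvg (fun t => act M (f t)) (act M p).
Proof.
by move=> [f1 f2 f3]; split; (apply: cvgD; first apply: cvgD);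
  apply: cvgM => //; exact: cvg_cst.
Qed.

Lemma vcvg_hpt (f : T -> R * R) (a : R * R) : a.2 != 0 ->
  (fun t => (f t).1) @ F --> a.1 -> (fun t => (f t).2) @ F --> a.2 ->
  vcvg (fun t => hpt (f t)) (hpt a).
Proof.
move=> a0 f1 f2.
have fV : (fun t => (f t).2^-1) @ F --> a.2^-1 by exact: cvgV.
split; [|exact: cvgM f1 fV|exact: fV].
exact: cvgM (cvgD (cvgM f1 f1) (cvgM f2 f2)) fV.
Qed.

End VectorLimits.

(** * Isolation of the extremal pairs *)

(** Twice the hyperbolic cosine of the distance to the point i. *)
Definition height (R : realType) (p : R * R * R) : R := p.1.1 + p.2.

(** The only transformations that can bring the distance down to [K] for a pair
    of points in a bounded region. *)
Definition near_orbit (R : realType) (Gamma : set 'M[R]_2) (K rho : R) :=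
  [set M | Gamma M /\ exists z w : upper R,
    [/\ height (hvec z) <= rho, height (hvec w) <= rho &
        mink (hvec z) (act M (hvec w)) <= K]].

Definition onsheet (R : realType) (p : R * R * R) := mink p p = 1 /\ 0 < p.2.

Lemma height_gt0 (R : realType) (p : R * R * R) : onsheet p -> 0 < height p.
Proof. by rewrite /onsheet /height /mink => -[? ?]; nra. Qed.

Lemma onsheet_hvec (R : realType) (z : upper R) : onsheet (hvec z).
Proof. by split; [exact: mink_hvecxx|rewrite /= invr_gt0 upper_gt0]. Qed.

Section Isolation.
Variables (R : realType) (Gamma : set 'M[R]_2) (K : R).
Hypothesis Gdet : forall M, Gamma M -> \det M = 1.
Hypothesis Gfin : forall rho, finite_set (near_orbit Gamma K rho).
Hypothesis Gcover : forall z w : upper R, exists2 M, Gamma M &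
  mink (hvec z) (act M (hvec w)) <= K.
Implicit Types (p q n : R * R * R) (M : 'M[R]_2).

Lemma near_orbitP rho p q M : onsheet p -> onsheet q ->
  height p <= rho -> height q <= rho ->
  Gamma M -> mink p (act M q) <= K -> near_orbit Gamma K rho M.
Proof.
move=> [p1 /(hvec_surj p1) [z <-]] [q1 /(hvec_surj q1) [w <-]] hp hq GM le.
by split=> //; exists z, w.
Qed.

Lemma cover_vec p q : onsheet p -> onsheet q ->
  exists2 M, Gamma M & mink p (act M q) <= K.
Proof.
by move=> [p1 /(hvec_surj p1) [z <-]] [q1 /(hvec_surj q1) [w <-]].
Qed.

(** Pushing [p] in a spacelike direction [n] normal to it.  The pushed point is
    c(s) p + s n with c(s) > 1, so that a function f_M with
    [mink n (act M q) = 0] is multiplied by c(s) and exceeds [K]; the finitely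
    many other ones that matter stay above [K] for small s by continuity. *)
Lemma no_neutral_normal p q n : onsheet p -> onsheet q ->
  mink n p = 0 -> mink n n < 0 ->
  (forall M, Gamma M -> K < mink p (act M q) \/
     mink p (act M q) = K /\ mink n (act M q) = 0) -> 0 < K -> False.
Proof.
move=> [p1 p2] [q1 q2] np nn H K0.
pose c s := Num.sqrt (1 - s ^+ 2 * mink n n).
pose ps s := comb (c s) p s n.
have pid : (fun s : R => s) @ (0 : R)^' --> (0 : R) by exact: nbhs_dnbhs.
have cc : c @ (0 : R)^' --> (1 : R).
  have E : (1 : R) = Num.sqrt (1 - 0 ^+ 2 * mink n n).
    by rewrite expr0n mul0r subr0 sqrtr1.
  rewrite [X in _ --> X]E; apply: (continuous_cvg _ (@sqrt_continuous R _)).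
  apply: cvgB; first exact: cvg_cst.
  by apply: cvgM; [exact: cvgM|exact: cvg_cst].
have psp : vcvg (0 : R)^' ps p.
  have <- : comb 1 p 0 n = p.
    by case: (p) => [[a b] d]; rewrite /comb /=; congr (_, _, _); ring.
  by apply: vcvg_comb => //; exact: vcvg_cst.
have ps1 s : mink (ps s) (ps s) = 1.
  rewrite mink_combl !mink_combr p1 (minkC p) np !mulr0 !mulr1 addr0 add0r.
  rewrite -expr2 sqr_sqrtr; first by ring.
  by rewrite subr_ge0 (le_trans _ ler01)// mulr_ge0_le0 ?sqr_ge0// ltW.
pose rho := height p + height q + 1.
have [s []] : exists s, [/\ 0 < (ps s).2, height (ps s) < rho &
    forall M, near_orbit Gamma K rho M -> K < mink (ps s) (act M q)].
  have [cp1 cp2 cp3] := psp.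
  apply: (@filter_ex _ (0 : R)^'); near=> s; split.
  - by near: s; apply: (cvgr_gt p.2).
  - near: s; apply: (cvgr_lt (height p)); first exact: cvgD.
    by rewrite /rho; have := height_gt0 (conj q1 q2); lra.
  - near: s; apply: near_finite => // M [GM _].
    have [KM|[KM nM]] := H M GM.
      apply: (cvgr_gt (mink p (act M q))) => //.
      by apply: cvg_mink => //; exact: vcvg_cst.
    near=> s; rewrite mink_combl KM nM mulr0 addr0 ltr_pMl//.
    rewrite -sqrtr1 ltr_sqrt; last first.
      by rewrite subr_gt0 (le_lt_trans _ ltr01)// mulr_ge0_le0 ?sqr_ge0// ltW.
    rewrite ltrDl oppr_gt0 nmulr_llt0// exprn_even_gt0//=.
    by near: s; exact: nbhs_dnbhs_neq.
move=> ps2 hs near_s; have ps_on := conj (ps1 s) ps2.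
have [M GM le] := cover_vec ps_on (conj q1 q2).
have : K < mink (ps s) (act M q).
  apply: near_s.
  apply: (near_orbitP ps_on (conj q1 q2) (ltW hs) _ GM le).
  by rewrite /rho; have := height_gt0 (conj p1 p2); lra.
by rewrite ltNge le.
Unshelve. all: by end_near. Qed.

Definition extremal (z w : upper R) :=
  forall M, Gamma M -> K <= mink (hvec z) (act M (hvec w)).

(** If [z0, w0] is extremal and [z, w] is another extremal pair near it, double
    the displacement from the first to the second: convexity makes every f_M at
    most [K] there equal to [K] and tangential, and the normal push
    [no_neutral_normal] contradicts [Gcover].  If [z0, w0] is not extremal, nor
    is any pair nearby. *)
Lemma extremal_isolated (z0 w0 : upper R) :
  \forall t \near (coords z0, coords w0), forall z w,
    t = (coords z, coords w) -> extremal z w -> z = z0 /\ w = w0.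
Proof.
set a := (coords z0, coords w0).
have Pc : vcvg (nbhs a) (fun t => hpt t.1) (hvec z0).
  apply: vcvg_hpt; first by rewrite gt_eqF// upper_gt0.
    exact: (cvg_comp _ _ cvg_fst cvg_fst).
  exact: (cvg_comp _ _ cvg_fst cvg_snd).
have Qc : vcvg (nbhs a) (fun t => hpt t.2) (hvec w0).
  apply: vcvg_hpt; first by rewrite gt_eqF// upper_gt0.
    exact: (cvg_comp _ _ cvg_snd cvg_fst).
  exact: (cvg_comp _ _ cvg_snd cvg_snd).
have [ext0|/existsNP[M /not_implyP[GM /negP]]] := pselect (extremal z0 w0);
  last first.
  rewrite -ltNge => lt; near=> t => z w tE /(_ M GM).
  rewrite leNgt => /negP; case; rewrite /hvec -[coords z]/((coords z, coords w).1)
    -[coords w]/((coords z, coords w).2) -tE; near: t.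
  apply: (cvgr_lt (mink (hvec z0) (act M (hvec w0)))) => //.
  by apply: cvg_mink => //; exact: vcvg_act.
set p0 := hvec z0 in Pc; set q0 := hvec w0 in Qc.
have R0 p : onsheet p -> preflect p p = p.
  case: p => [[x y] u] [p1 _]; rewrite /preflect p1 /comb /=.
  by congr (_, _, _); ring.
pose p2 (t : (R * R) * (R * R)) := preflect (hpt t.1) p0.
pose q2 (t : (R * R) * (R * R)) := preflect (hpt t.2) q0.
have p2c : vcvg (nbhs a) p2 p0.
  rewrite -[X in vcvg _ _ X](R0 p0); last exact: onsheet_hvec.
  by apply: vcvg_preflect => //; exact: vcvg_cst.
have q2c : vcvg (nbhs a) q2 q0.
  rewrite -[X in vcvg _ _ X](R0 q0); last exact: onsheet_hvec.
  by apply: vcvg_preflect => //; exact: vcvg_cst.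
pose rho := height p0 + height q0 + 1.
have [p2c1 p2c2 p2c3] := p2c; have [q2c1 q2c2 q2c3] := q2c.
have K_ge1 : 1 <= K.
  have [M GM] := Gcover z0 w0; apply: le_trans.
  by have [w _ <-] := mobius_upper w0 (Gdet GM); exact: mink_hvec_ge1.
pose close t := [/\ 0 < (p2 t).2, 0 < (q2 t).2,
  height (p2 t) < rho, height (q2 t) < rho &
  forall M, near_orbit Gamma K rho M ->
    K < mink p0 (act M q0) -> K < mink (p2 t) (act M (q2 t))].
have near_t : \forall t \near a, close t.
  near=> t; split.
  - by near: t; apply: (cvgr_gt _ p2c3) => //; have [] := onsheet_hvec z0.
  - by near: t; apply: (cvgr_gt _ q2c3); have [] := onsheet_hvec w0.
  - near: t; apply: (cvgr_lt (height p0)); first exact: cvgD.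
    by rewrite /rho; have := height_gt0 (onsheet_hvec w0); lra.
  - near: t; apply: (cvgr_lt (height q0)); first exact: cvgD.
    by rewrite /rho; have := height_gt0 (onsheet_hvec z0); lra.
  - near: t; apply: near_finite => // M _.
    have [lt|le] := ltP K (mink p0 (act M q0)); last by apply: nearW => t.
    have cM : (fun t => mink (p2 t) (act M (q2 t))) @ nbhs a -->
        mink p0 (act M q0).
      by apply: cvg_mink => //; exact: vcvg_act.
    have H : \forall t \near a, K < mink (p2 t) (act M (q2 t)).
      exact: (@cvgr_gt _ _ _ (nbhs_filter a) _ _ cM).
    by near=> t => _; near: t.
near=> t => z w tE ext; have [] : close t by near: t.
rewrite /p2 /q2 tE /= -!/(hvec _).
set p1 := hvec z; set q1 := hvec w => p2_gt0 q2_gt0 p2h q2h near_M.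
have p2s : onsheet (preflect p1 p0).
  by split=> //; apply: mink_preflect; exact: mink_hvecxx.
have q2s : onsheet (preflect q1 q0).
  by split=> //; apply: mink_preflect; exact: mink_hvecxx.
have p1_ge := mink_hvec_ge1 z z0; have q1_ge := mink_hvec_ge1 w w0.
have [zw|zw] := boolP ((1 < mink p1 p0) || (1 < mink q1 q0)); last first.
  move: zw; rewrite negb_or -!leNgt => /andP[zE wE].
  by split; apply/mink_hvec_eq1/le_anti/andP.
have {}zw := orP zw; exfalso.
have key M : Gamma M ->
   K < mink (preflect p1 p0) (act M (preflect q1 q0)) \/
   [/\ mink (preflect p1 p0) (act M (preflect q1 q0)) = K, 1 < mink p1 p0 &
      vdet p1 p0 (act M (preflect q1 q0)) = 0].
  move=> GM; set f2 := mink _ (act M (preflect q1 q0)).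
  have [lt|le] := ltP K f2; first by left.
  right; have M_near : near_orbit Gamma K rho M.
    by apply: (near_orbitP p2s q2s _ _ GM) => //; exact: ltW.
  have f0 : mink p0 (act M q0) = K.
    apply/le_anti/andP; split; last exact: ext0.
    by rewrite leNgt; apply/negP => /(near_M M M_near); rewrite ltNge le.
  have actR : act M (preflect q1 q0) = preflect (act M q1) (act M q0).
    by rewrite act_comb /preflect mink_act// Gdet.
  rewrite /f2 actR -f0; apply: mink_convex; rewrite ?mink_act ?mink_hvecxx ?Gdet//.
  - by rewrite f0 K_ge1 ext.
  - by rewrite -actR f0.
(* If p1 = p0 the tangential case cannot occur, and the normal vector would be
   zero. *)
have [p1_gt|p1_le] := ltP 1 (mink p1 p0).
  apply: (@no_neutral_normal _ _ (mcross p1 p0) p2s q2s);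
    last exact: lt_le_trans K_ge1.
  - by rewrite mink_cross /preflect /vdet /=; ring.
  - by rewrite mink_crossxx !mink_hvecxx; nra.
  - move=> M /key[|[-> _ det0]]; first by left.
    by right; split=> //; rewrite mink_cross.
have [M GM] := cover_vec p2s q2s; rewrite leNgt => /negP; apply.
by have [//|[_ lt _]] := key M GM; have := lt_le_trans lt p1_le; rewrite ltxx.
Unshelve. all: by end_near. Qed.

End Isolation.

(** * Finiteness in compact regions *)

(** Otherwise the cofinite subsets of [A `&` C] generate a proper filter on
    [C], and a cluster point of it is not isolated. *)
Lemma compact_isolated_finite (T : topologicalType) (C A : set T) :
  compact C -> (forall t, C t -> \forall t' \near t, A t' -> t' = t) ->
  finite_set (A `&` C).
Proof.
move=> cC isoA; apply: contrapT => infAC.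
pose F : set_system T := [set B | finite_set ((A `&` C) `\` B)].
have FF : ProperFilter F.
  split; first by rewrite /F /= setD0.
  split; rewrite /F /=.
  - by rewrite setDT; exact: finite_set0.
  - move=> P Q FP FQ; suff : finite_set ((A `&` C) `\` (P `&` Q)) by [].
    by rewrite setDIr finite_setU.
  - by move=> P Q PQ; apply: sub_finite_set; exact: setDS.
have FC : F C by rewrite /F /= -setIDA setDv setI0; exact: finite_set0.
have [t [Ct clt]] := cC F FF FC.
have Ft : F ((A `&` C) `\` [set t]).
  rewrite /F /=; apply: (@sub_finite_set _ _ [set t]); last exact: finite_set1.
  by move=> u [ACu nu]; apply: contrapT => ut; apply: nu.
by have [u [[[Au _] ut] /(_ Au)]] := clt _ _ Ft (isoA t Ct).
Qed.

Section Compactness.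
Variables (R : realType) (Gamma : set 'M[R]_2) (K : R).
Hypothesis Gdet : forall M, Gamma M -> \det M = 1.
Hypothesis Gfin : forall rho, finite_set (near_orbit Gamma K rho).
Hypothesis Gcover : forall z w : upper R, exists2 M, Gamma M &
  mink (hvec z) (act M (hvec w)) <= K.

Lemma height_box (z : upper R) (B : R) : height (hvec z) <= B ->
  (coords z).1 \in `[- B, B] /\ (coords z).2 \in `[B^-1, B].
Proof.
case: z => [[x y] /= y0]; rewrite /height /hvec /hpt /= !in_itv /= => H.
have H1 : x ^+ 2 + y ^+ 2 + 1 <= B * y.
  by rewrite -ler_pdivrMr// mulrDl mul1r.
have B0 : 0 < B by have := sqr_ge0 x; have := sqr_ge0 y; nra.
have yB : y <= B by have := sqr_ge0 x; nra.
split; first by apply/andP; split; have := sqr_ge0 y; nra.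
rewrite yB andbT -div1r ler_pdivrMr// mulrC.
by have := sqr_ge0 x; have := sqr_ge0 y; lra.
Qed.

Lemma finite_extremal (B : R) : finite_set [set zw : upper R * upper R |
  extremal Gamma K zw.1 zw.2 /\
  height (hvec zw.1) <= B /\ height (hvec zw.2) <= B].
Proof.
pose pt (zw : upper R * upper R) := (coords zw.1, coords zw.2).
have pt_inj : injective pt.
  move=> [z w] [z' w'] E.
  by congr (_, _); apply/coords_inj; [exact: (congr1 fst E)|exact: (congr1 snd E)].
have [B0|B0] := leP B 0.
  rewrite (_ : [set _ | _] = set0)// -subset0 => -[z w] [_ [h _]] /=.
  have [/= _] := height_box h; rewrite in_itv /= => /andP[_].
  by have := upper_gt0 z => ? ?; lra.
pose box : set (R * R) := `[- B, B] `*` `[B^-1, B].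
have cbox : compact (box `*` box).
  by do !apply: compact_setX; exact: segment_compact.
have fin : finite_set ([set t | exists2 zw, t = pt zw &
    extremal Gamma K zw.1 zw.2] `&` (box `*` box)).
  apply: compact_isolated_finite cbox _ => -[[x y] [x' y']].
  rewrite /box /= !in_itv /= => -[[_ /andP[yB _]] [_ /andP[y'B _]]].
  have BV : 0 < B^-1 by rewrite invr_gt0.
  pose z0 := Upper (upper_val := Complex x y) (lt_le_trans BV yB).
  pose w0 := Upper (upper_val := Complex x' y') (lt_le_trans BV y'B).
  have := extremal_isolated Gdet Gfin Gcover z0 w0.
  apply: filterS => t H [[z w] tE ext].
  by rewrite tE; have [-> ->] := H z w tE ext.
apply: (sub_finite_set _ (finite_preimage _ fin)); last first.
  by move=> x y _ _; exact: pt_inj.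
move=> [z w] [/= ext [hz hw]]; split; first by exists (z, w).
by have [? ?] := height_box hz; have [? ?] := height_box hw.
Qed.

End Compactness.

(** * Inverse hyperbolic cosine *)

Section Arcosh.
Variable R : realType.
Implicit Types u v : R.

Lemma arcosh_arg_gt0 u : 1 <= u -> 0 < u + Num.sqrt (u ^+ 2 - 1).
Proof. by move=> u1; have := sqrtr_ge0 (u ^+ 2 - 1); lra. Qed.

Lemma ltr_arcosh u v : 1 <= u -> u < v -> arcosh u < arcosh v.
Proof.
move=> u1 uv; have v1 : 1 <= v by lra.
rewrite /arcosh ltr_ln ?posrE ?arcosh_arg_gt0// ltr_leD// ler_wsqrtr//; nra.
Qed.

Lemma ler_arcosh u v : 1 <= u -> u <= v -> arcosh u <= arcosh v.
Proof. by move=> u1; rewrite le_eqVlt => /orP[/eqP->//|/(ltr_arcosh u1)/ltW]. Qed.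

Lemma arcosh_ge0 u : 1 <= u -> 0 <= arcosh u.
Proof. by move=> u1; apply: ln_ge0; have := sqrtr_ge0 (u ^+ 2 - 1); lra. Qed.

Lemma le_expR_arcosh u : 1 <= u -> u <= expR (arcosh u).
Proof. by move=> u1; rewrite lnK ?posrE ?arcosh_arg_gt0// lerDl sqrtr_ge0. Qed.

End Arcosh.

(** * Distance and diameter on the surface *)

Section BasePoint.
Variable R : realType.
Implicit Types z w : upper R.

Definition upper_i : upper R := @Upper R (Complex 0 1) ltr01.

Lemma heightE z : height (hvec z) = 2 * mink (hvec upper_i) (hvec z).
Proof.
by rewrite /height /mink /hvec /hpt /=; field; rewrite gt_eqF ?upper_gt0.
Qed.

Lemma mink_hvec_triangle o z w : mink (hvec z) (hvec w) <=
  2 * mink (hvec o) (hvec z) * mink (hvec o) (hvec w).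
Proof. by apply: mink_triangle; rewrite ?mink_hvecxx ?mink_hvec_ge1. Qed.

End BasePoint.

Section Surface.
Variables (R : realType) (g : nat) (X : marked_surface R g).
Implicit Types (z w : upper R) (M N : 'M[R]_2).

Definition deck : set 'M[R]_2 := range (eval_word (hol X)).

Lemma deck_det M : deck M -> \det M = 1.
Proof. by move=> [u _ <-]; exact: eval_word_det. Qed.

Lemma deckM M N : deck M -> deck N -> deck (M *m N).
Proof.
by move=> [u _ <-] [v _ <-]; exists (u ++ v) => //; exact: eval_word_cat.
Qed.

Lemma act_mul M N (p : R * R * R) : act (M *m N) p = act M (act N p).
Proof. by rewrite /act !mulmx2 /=; congr (_, _, _); ring. Qed.

Lemma surface_proj_eq z w : surface_proj X z = surface_proj X w <->
  exists2 M, deck M & hvec w = act M (hvec z).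
Proof.
split.
  move=> /eqmodP/asboolP[u zw]; exists (eval_word (hol X) u); first by exists u.
  have [w' w'E <-] := mobius_upper z (eval_word_det X u).
  by congr hvec; apply/val_inj; rewrite /= -w'E.
move=> [_ [u _ <-] wE]; apply/eqmodP/asboolP; exists u.
have [w' -> w'E] := mobius_upper z (eval_word_det X u).
congr upper_val; apply: mink_hvec_eq1; rewrite w'E -wE; exact: mink_hvecxx.
Qed.

Lemma surface_surj (p : surface X) : exists z, surface_proj X z = p.
Proof. by exists (repr p); rewrite /surface_proj reprK. Qed.

(** Proper discontinuity, recentred at i. *)
Lemma near_orbit_finite (K rho : R) : finite_set (near_orbit deck K rho).
Proof.
pose r := arcosh (Num.max (rho / 2) (rho * K)).
apply: sub_finite_set (hol_properly_discontinuous X (upper_i R) r).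
move=> M [dM [z [w]]].
rewrite !heightE => -[hz hw hM]; split=> //.
have [w' ww' w'E] := mobius_upper w (deck_det dM).
rewrite -w'E in hM.
have mink_ge0 (a b : upper R) : 0 <= mink (hvec a) (hvec b).
  exact: le_trans ler01 (mink_hvec_ge1 a b).
exists w, w'; split=> //; rewrite hyp_distE; apply: ler_arcosh;
  rewrite ?mink_hvec_ge1// le_max; apply/orP; [left; lra|right].
apply: (le_trans (mink_hvec_triangle z _ _)).
by apply: ler_pM => //; [rewrite mulr_ge0|rewrite minkC].
Qed.

Lemma hyp_dist_ge0 z w : 0 <= hyp_dist z w.
Proof. by rewrite hyp_distE; apply: arcosh_ge0; exact: mink_hvec_ge1. Qed.

Lemma surface_dist_le z w :
  surface_dist (surface_proj X z) (surface_proj X w) <= hyp_dist z w.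
Proof.
apply: ge_inf; last by exists z, w.
by exists 0 => _ [z' [w' [_ _ ->]]]; exact: hyp_dist_ge0.
Qed.

Lemma surface_dist_le_deck z w M : deck M ->
  surface_dist (surface_proj X z) (surface_proj X w) <=
  arcosh (mink (hvec z) (act M (hvec w))).
Proof.
move=> dM; have [w' _ w'E] := mobius_upper w (deck_det dM).
have -> : surface_proj X w = surface_proj X w'.
  by apply/surface_proj_eq; exists M.
by rewrite -w'E -hyp_distE surface_dist_le.
Qed.

Lemma mink_deck_ge1 z w M : deck M -> 1 <= mink (hvec z) (act M (hvec w)).
Proof.
by move=> dM; have [w' _ <-] := mobius_upper w (deck_det dM); exact: mink_hvec_ge1.
Qed.

(** By proper discontinuity only finitely many deck transformations bring [w]
    within distance d + 1 of [z], where d is the infimum; if none of them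
    attained d, they would stay at distance at least d + e. *)
Lemma surface_dist_attained z w : exists2 M, deck M &
  arcosh (mink (hvec z) (act M (hvec w))) =
  surface_dist (surface_proj X z) (surface_proj X w).
Proof.
set d := surface_dist _ _; pose h M := arcosh (mink (hvec z) (act M (hvec w))).
apply: contrapT => noM.
have d_lt M : deck M -> d < h M.
  move=> dM; rewrite lt_neqAle surface_dist_le_deck// andbT.
  by apply/eqP => E; apply: noM; exists M.
have fin : finite_set [set M | deck M /\ h M <= d + 1].
  pose rho := height (hvec z) + height (hvec w).
  apply: sub_finite_set (near_orbit_finite (expR (d + 1)) rho).
  move=> M [dM le]; split=> //; exists z, w.
  have := height_gt0 (onsheet_hvec z); have := height_gt0 (onsheet_hvec w).
  rewrite /rho; split; [lra|lra|].
  apply: (le_trans (le_expR_arcosh (mink_deck_ge1 z w dM))).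
  by rewrite ler_expR.
have [e [e0 e1 eh]] : exists e : R, [/\ 0 < e, e <= 1 &
    forall M, deck M /\ h M <= d + 1 -> d + e < h M].
  apply: (@filter_ex _ (0 : R)^'+); near=> e; split.
  - by near: e; exact: nbhs_right_gt.
  - by near: e; exact: nbhs_right_le.
  - near: e; apply: near_finite => // M [dM _].
    near=> e; rewrite -ltrBrDl; near: e; apply: nbhs_right_lt.
    by rewrite subr_gt0 d_lt.
have [_ [z' [w' [zz' ww' ->]]]] : exists2 x, [set x | exists z' w' : upper R,
    [/\ surface_proj X z' = surface_proj X z,
      surface_proj X w' = surface_proj X w & x = hyp_dist z' w']] x & x < d + e.
  apply: inf_adherent => //; split; first by exists (hyp_dist z w), z, w.
  by exists 0 => _ [z' [w' [_ _ ->]]]; exact: hyp_dist_ge0.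
rewrite hyp_distE.
have [M dM zE] := (surface_proj_eq z' z).1 zz'.
have [N dN wE] := (surface_proj_eq w w').1 (esym ww').
have -> : mink (hvec z') (hvec w') = mink (hvec z) (act (M *m N) (hvec w)).
  by rewrite zE act_mul -wE mink_act// deck_det.
rewrite -/(h _) => lt; have dMN := deckM dM dN.
have := eh (M *m N); rewrite ltNge (ltW lt) => /(_ _)/negP; apply.
by split=> //; lra.
Unshelve. all: by end_near. Qed.

Lemma bounded_lift : exists B, forall p : surface X,
  exists2 z, surface_proj X z = p & height (hvec z) <= B.
Proof.
have [z0 [r cocompact]] := hol_cocompact X.
exists (2 * (2 * mink (hvec z0) (hvec (upper_i R)) * expR r)) => p.
have [z <-] := surface_surj p; have [u [z' [zz' z'r]]] := cocompact z.
exists z'; first by apply/esym/eqmodP/asboolP; exists u.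
rewrite heightE ler_pM2l//; apply: (le_trans (mink_hvec_triangle z0 _ _)).
rewrite ler_wpM2l//.
  by rewrite mulr_ge0// (le_trans ler01)// mink_hvec_ge1.
apply: (le_trans (le_expR_arcosh (mink_hvec_ge1 _ _))).
by rewrite ler_expR -hyp_distE.
Qed.

(** The distances are bounded by cocompactness, so that the diameter is an
    actual supremum and not the default value of [sup]. *)
Lemma surface_dist_le_diameter (p q : surface X) : surface_dist p q <= diameter X.
Proof.
have [B hB] := bounded_lift; apply: ub_le_sup; last by exists p, q.
exists (arcosh (B * B)) => _ [{}p [{}q ->]].
have [z <- hz] := hB p; have [w <- hw] := hB q.
apply: (le_trans (surface_dist_le z w)); rewrite hyp_distE.
apply: ler_arcosh; first exact: mink_hvec_ge1.
apply: (le_trans (mink_hvec_triangle (upper_i R) z w)).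
have := mink_hvec_ge1 (upper_i R) z; have := mink_hvec_ge1 (upper_i R) w.
rewrite !heightE in hz hw; move: hz hw.
move: (mink _ _) (mink _ _) => a b ha hb b1 a1; nra.
Qed.

Theorem diameter_locus_finite : finite_set (diameter_locus X).
Proof.
have [[[p0 q0] /= diam0]|no_pair] := pselect (diameter_pairs X !=set0);
  last first.
  rewrite (_ : diameter_locus X = set0)//; apply/seteqP; split=> // p [pq dpq _].
  by apply: no_pair; exists pq.
have [z0 zE] := surface_surj p0; have [w0 wE] := surface_surj q0.
have [M0 dM0] := surface_dist_attained z0 w0.
set K := mink _ _; rewrite zE wE diam0 => KE.
have K1 : 1 <= K by exact: mink_deck_ge1.
have cover z w : exists2 M, deck M & mink (hvec z) (act M (hvec w)) <= K.
  have [M dM hM] := surface_dist_attained z w; exists M => //.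
  rewrite leNgt; apply/negP => /(ltr_arcosh K1).
  by rewrite hM KE ltNge surface_dist_le_diameter.
have [B hB] := bounded_lift.
have fin := finite_extremal deck_det (near_orbit_finite K) cover B.
have fin1 := finite_image (fun zw => surface_proj X zw.1) fin.
have fin2 := finite_image (fun zw => surface_proj X zw.2) fin.
apply: sub_finite_set (_ : finite_set (_ `|` _)); last first.
  by rewrite finite_setU; split; [exact: fin1|exact: fin2].
move=> p [[p1 q1] /= d1 pE].
have [z zp hz] := hB p1; have [w wq hw] := hB q1.
have ext : extremal deck K z w.
  move=> M dM; rewrite leNgt; apply/negP => /(ltr_arcosh (mink_deck_ge1 z w dM)).
  by rewrite KE -d1 -zp -wq ltNge surface_dist_le_deck.
by case: pE => ->; [left|right]; exists (z, w).
Qed.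

End Surface.

Theorem proposition3 (R : realType) (g : nat) (hg : (2 <= g)%N)
    (x : teichmuller R g) (X : marked_surface R g) (hX : teich_class X = x) :
  exists G : finite_graph X,
    [/\ smoothly_embedded G, graph_support G = diameter_locus X &
        (graph_dim G <= 1)%N].
Proof.
have [s sE] := (finite_seqP _).1 (diameter_locus_finite X).
have no_edge (i : 'I_0) : R -> upper R by case: i.
exists (@FiniteGraph R g X s 0 no_edge); split=> //.
- by split=> [[]|[]|[]|[]].
- rewrite sE; apply/seteqP; split=> p; last by left.
  by case=> [//|[[]]].
Qed.
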